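(* There exists $d_0$ such that for every integer $d \ge d_0$, $$f(d) \ge (1.2)^{\sqrt{d}},$$ where $f(d)$ denotes the smallest number such that every set in $\mathbb{R}^d$ of diameter $1$ can be partitioned into $f(d)$ sets of diameter smaller than $1$.
   Context: $\mathbb{R}^d$ carries the Euclidean metric, and the diameter of a set is the supremum of the distances between pairs of its points. For a positive integer $d$, $f(d)$ is the smallest positive integer $N$ such that every subset of $\mathbb{R}^d$ of diameter $1$ can be partitioned into $N$ subsets each of diameter strictly smaller than $1$. Parts of a partition are allowed to be empty, so ''partitioned into $N$ sets'' means into at most $N$ nonempty sets. Such an $N$ exists for every $d$. *)

(* Defs.v *)
From mathcomp Require Import all_boot all_order all_algebra.
From mathcomp Require Import all_classical all_reals all_analysis.

Set Implicit Arguments.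
Unset Strict Implicit.
Unset Printing Implicit Defensive.

Import Order.TTheory GRing.Theory Num.Theory.

Local Open Scope classical_set_scope.
Local Open Scope ring_scope.

(* The library's norm on 'rV[R]_d is the sup norm, so the Euclidean distance
   is written out. *)
Definition euclidean_dist (R : realType) (d : nat) (x y : 'rV[R]_d) : R :=
  Num.sqrt (\sum_(i < d) (x ord0 i - y ord0 i) ^+ 2).

(* Extended-real supremum: +oo on unbounded sets and -oo on the empty set, so
   that an empty part always has diameter smaller than 1. *)
Definition diameter (R : realType) (d : nat) (A : set 'rV[R]_d) : \bar R :=
  ereal_sup [set (euclidean_dist x y)%:E | x in A & y in A].

(* The parts P i may be empty; this is why the library's [partition], which
   requires nonempty blocks, is not used. *)
Definition borsuk_partition (R : realType) (d N : nat) (A : set 'rV[R]_d)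
    (P : 'I_N -> set 'rV[R]_d) : Prop :=
  [/\ cover setT P = A, trivIset setT P &
      forall i, (diameter (P i) < 1%:E)%E].

Definition borsuk_bound (R : realType) (d N : nat) : Prop :=
  (0 < N)%N /\
  forall A : set 'rV[R]_d, diameter A = 1%:E ->
    exists P : 'I_N -> set 'rV[R]_d, borsuk_partition A P.

(* A set of diameter 1 lies in a cube of side 2, which is cut into small
   cubes of side 1 / d.+1. *)
Lemma borsuk_bound_exists (R : realType) (d : nat) :
  exists N, `[< borsuk_bound R d N >].
Proof.
pose C := {ffun 'I_d -> 'I_(2 * d.+1).+1}.
exists #|C|; apply/asboolP; split.
  by apply/card_gt0P; exists [ffun=> ord0].
move=> A dA.
have [a Aa] : A !=set0.
  apply/set0P/eqP => A0; move: dA; rewrite A0 /diameter.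
  have -> : [set (euclidean_dist x y)%:E | x in (set0 : set 'rV[R]_d) &
     y in (set0 : set 'rV[R]_d)] = set0 by apply/seteqP; split=> z //= [x []].
  by rewrite ereal_sup0.
have le1 x i : A x -> `|x ord0 i - a ord0 i| <= 1.
  move=> Ax; have : (((euclidean_dist x a)%:E : \bar R) <= 1%:E)%E.
    by rewrite -dA; apply: ereal_sup_ubound; exists x => //; exists a.
  rewrite lee_fin; apply: le_trans.
  rewrite -sqrtr_sqr /euclidean_dist ler_wsqrtr //.
  by rewrite (bigD1 i) //= lerDl sumr_ge0 // => j _; exact: sqr_ge0.
pose z (x : 'rV[R]_d) i : R := (x ord0 i - a ord0 i + 1) * d.+1%:R.
have z_ge0 x i : A x -> 0 <= z x i.
  by move=> /(le1 x i); rewrite ler_norml => /andP[? _]; rewrite mulr_ge0 // -lerBlDr sub0r.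
have z_le x i : A x -> z x i <= (2 * d.+1)%:R.
  move=> /(le1 x i); rewrite ler_norml => /andP[_ ?].
  by rewrite natrM ler_wpM2r // -[2%:R]/(1 + 1) lerD2r.
pose c (x : 'rV[R]_d) : C := [ffun i => inord (Num.truncn (z x i))].
exists (fun i => [set x | A x /\ enum_rank (c x) = i]); split.
- apply/seteqP; split=> [x [i _ [] //]|x Ax].
  by exists (enum_rank (c x)).
- by move=> i j _ _ [x [[_ <-] [_ <-]]].
move=> k.
have lt1 : Num.sqrt (d%:R / d.+1%:R ^+ 2 : R) < 1.
  rewrite -[ltRHS]sqrtr1 ltr_sqrt // ltr_pdivrMr ?exprn_gt0 // mul1r.
  by rewrite -natrX ltr_nat expnS expn1 leq_pmulr.
apply: (@le_lt_trans _ _ (Num.sqrt (d%:R / d.+1%:R ^+ 2 : R))%:E);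
  last by rewrite lte_fin.
apply: ge_ereal_sup => _ [x [Ax cx] [y [Ay cy] <-]].
rewrite lee_fin /euclidean_dist ler_wsqrtr //.
apply: (@le_trans _ _ (\sum_(i < d) (d.+1%:R ^- 2 : R))); last first.
  by rewrite sumr_const card_ord -[_ *+ d]mulr_natl.
apply: ler_sum => i _.
have cxy : Num.truncn (z x i) = Num.truncn (z y i).
  have lt_tr w : A w -> (Num.truncn (z w i) < (2 * d.+1).+1)%N.
    move=> Aw; rewrite ltnS -(ler_nat R); apply: le_trans (z_le w i Aw).
    by rewrite truncn_le z_ge0.
  have /ffunP/(_ i) : c x = c y by apply: enum_rank_inj; rewrite cx cy.
  by rewrite !ffunE => /(congr1 val) /=; rewrite !inordK ?lt_tr.
have /andP[x1 x2] := truncn_itv (z_ge0 x i Ax).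
have /andP[y1 y2] := truncn_itv (z_ge0 y i Ay).
rewrite cxy in x1 x2.
have zz : `|z x i - z y i| <= 1.
  rewrite ler_norml lerNl opprB !lerBlDr [1 + z x i]addrC [1 + z y i]addrC.
  rewrite (le_trans (ltW y2)) ?(le_trans (ltW x2)) //.
    by rewrite -natr1 lerD2r.
  by rewrite -natr1 lerD2r.
rewrite -[leRHS]mul1r ler_pdivlMr ?exprn_gt0 // -exprMn.
rewrite -real_normK ?num_real // expr_le1 //.
suff -> : (x ord0 i - y ord0 i) * d.+1%:R = z x i - z y i by [].
by rewrite /z -mulrBl opprD addrACA subrr addr0 opprB addrA subrK.
Qed.

Definition borsuk_number (R : realType) (d : nat) : nat :=
  ex_minn (borsuk_bound_exists R d).

(* Main.v *)
(* Let p be prime and let x run over the vectors of {-1,0,1}^n with p - 1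
   nonzero entries.  Put x' = (1, x), so that <x', x'> = p, and map x to the
   tensor square of x', which lives in dimension (n + 1)(n + 2)/2.  Up to
   scaling, the squared distance between two images is p^2 - <x', y'>^2, so the
   diameter is attained exactly at <x', y'> = 0, i.e. <x, y> = -1.  Modulo p the
   polynomials prod_(k < p - 1) (<x, y> - k) in y vanish at y <> x unless
   <x, y> = -1, hence (Frankl-Wilson) a part of smaller diameter has at most M
   elements, where M counts the exponents in {0,1,2}^n of total degree at most
   p - 1, and M z^(p-1) <= (1 + z + z^2)^n for 0 < z <= 1.  The number of parts
   is therefore at least C(n, p - 1) (2z)^(p-1) / (1 + z + z^2)^n.

   With Raigorodskii's choice of vectors this exceeds 1.2^(n / sqrt 2) by an
   exponential factor whenever p / n lies between about 0.29 and 0.55.  So it is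
   enough to take n = 26 k and a prime p in (8 k, 14 k]; such a prime is found
   by Erdos's argument for Bertrand's postulate applied to C(14 k, 7 k), the
   primes in (7 k, 8 k] being absorbed by C(8 k, 7 k). *)

Require Import Defs.
From mathcomp Require Import all_boot all_order all_algebra.
From mathcomp Require Import all_classical all_reals all_analysis.
From mathcomp Require Import zify ring lra.

Set Implicit Arguments.
Unset Strict Implicit.
Unset Printing Implicit Defensive.

Import Order.TTheory GRing.Theory Num.Theory.

(** * A prime between 8k and 14k *)

(** Distinct primes are pairwise coprime, so their product divides [N] as soon as each of them
    does. *)
Lemma leq_prod_primes (b N : nat) (P : pred nat) : 0 < N ->
  (forall p, prime p -> P p -> p %| N) ->
  \prod_(0 <= p < b | prime p && P p) p <= N.
Proof.
move=> N0 PN; apply: dvdn_leq => //.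
elim: b => [|b IH]; first by rewrite big_geq.
rewrite big_mkcond big_nat_recr //= -big_mkcond /=.
case: ifP => [/andP[pb Pb]|_]; last by rewrite muln1.
rewrite Gauss_dvd ?IH ?PN // coprime_sym big_seq_cond.
elim/big_ind: _ => [|x y cx cy|p].
- exact: coprimen1.
- by rewrite coprimeMr cx.
rewrite mem_index_iota => /andP[/andP[_ pltb] /andP[pp _]].
by rewrite prime_coprime // dvdn_prime2 // gtn_eqF.
Qed.

Lemma prime_dvd_fact (p n : nat) : prime p -> (p %| n`!) = (p <= n).
Proof.
move=> pp; elim: n => [|n IH]; first by rewrite fact0 dvdn1 gtn_eqF ?prime_gt1 // leqNgt prime_gt0.
rewrite factS Euclid_dvdM // IH [RHS]leq_eqVlt ltnS.
case: (ltngtP p n.+1) => [lt|gt|->]; last by rewrite dvdnn.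
- by rewrite -ltnS lt orbT.
- by rewrite gtnNdvd // leqNgt (ltnW gt).
Qed.

(** [p] divides the numerator [n!] but neither of the factorials in the denominator. *)
Lemma prime_dvd_bin (p n m : nat) : prime p -> m < p -> n - m < p -> p <= n ->
  p %| 'C(n, m).
Proof.
move=> pp mp nmp pn.
have mn : m <= n by lia.
have : p %| n`! by rewrite prime_dvd_fact.
rewrite -(bin_fact mn) !Euclid_dvdM // !prime_dvd_fact //.
by rewrite ![p <= _]leqNgt mp nmp !orbF.
Qed.

(** Erdos's strong induction: an even [n > 2] is not prime, and for [n = 2m + 1] the primes above
    [m + 1] all divide ['C(n, m)]. *)
Lemma primorial_le (n : nat) : \prod_(0 <= p < n.+1 | prime p) p <= 4 ^ n.
Proof.
elim/ltn_ind: n => n IH.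
case: (leqP n 2) => [|n2].
  by case: n {IH} => [|[|[|n]]] // _; rewrite big_mkcond /index_iota /= unlock.
have [m nE] : exists m, n = m.*2 \/ n = m.*2.+1.
  by exists n./2; have := odd_double_half n; case: odd; lia.
case: nE => nE.
  have pn : prime n = false.
    apply/negP => pn; have : 2 %| n by rewrite nE -muln2 dvdn_mull.
    by rewrite dvdn_prime2 // => /eqP; lia.
  rewrite big_mkcond big_nat_recr //= pn muln1 -big_mkcond /=.
  case: n n2 IH {nE pn} => // n n2 IH.
  by rewrite (leq_trans (IH n _)) // leq_exp2l.
rewrite (bigID (fun p => p <= m.+1)) /=.
have -> : \prod_(0 <= p < n.+1 | prime p && (p <= m.+1)) p =
    \prod_(0 <= p < m.+2 | prime p) p.
  rewrite [RHS](@big_nat_widen _ _ _ _ _ n.+1); last by lia.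
  by apply: eq_bigl => p; rewrite ltnS.
(* ['C(n, m)] and ['C(n, m.+1)] are equal and both occur in the expansion of [2 ^ (2m + 1)]. *)
have binle : 'C(n, m) <= 4 ^ m.
  have : 'C(n, m) + 'C(n, m.+1) <= 2 ^ n.
    have <- : \sum_(i < n.+1) 'C(n, i) = 2 ^ n.
      rewrite -[2]/(1 + 1) expnDn; apply: eq_bigr => i _.
      by rewrite !exp1n !muln1.
    have mn : m < n.+1 by lia.
    have mn1 : m.+1 < n.+1 by lia.
    rewrite (bigD1 (Ordinal mn)) //= (bigD1 (Ordinal mn1)) /=; last first.
      by rewrite -val_eqE /=; lia.
    by rewrite addnA leq_addr.
  rewrite -bin_sub; last by lia.
  rewrite (_ : n - m = m.+1); last by lia.
  rewrite -[4]/(2 ^ 2) -expnM nE mul2n expnS; lia.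
have le2 : \prod_(0 <= p < n.+1 | prime p && ~~ (p <= m.+1)) p <= 'C(n, m).
  rewrite big_nat_cond.
  under eq_bigl => p do rewrite andbC -andbA.
  apply: (@leq_prod_primes _ _ (fun p => ~~ (p <= m.+1) && (0 <= p < n.+1))) => [|p pp /andP[]]; first by rewrite bin_gt0; lia.
  by move=> p1 p2; apply: prime_dvd_bin => //; lia.
have -> : 4 ^ n = 4 ^ m.+1 * 4 ^ m by rewrite -expnD; congr (_ ^ _); lia.
by apply: leq_mul; [apply: IH; lia|apply: leq_trans binle].
Qed.

(** Legendre's formula with a free upper limit, so that the sums for [m!] and [(m + m)!] can be
    compared term by term. *)
Lemma logn_fact_le (p n N : nat) : prime p -> n <= N ->
  logn p n`! = \sum_(1 <= k < N.+1) n %/ p ^ k.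
Proof.
move=> pp nN; rewrite logn_fact // [RHS](@big_cat_nat _ _ _ n.+1) //=.
rewrite [X in _ + X]big_nat_cond [X in _ + X]big1 ?addn0 // => k /andP[/andP[nk _] _].
by rewrite divn_small // (leq_trans nk) // ltnW // ltn_expl // prime_gt1.
Qed.

(** Kummer's carry count: the k-th Legendre terms differ by 1 exactly when doubling [m %% p ^ k]
    reaches [p ^ k]. *)
Lemma logn_central_bin (p m : nat) : prime p ->
  logn p 'C(m + m, m) =
  \sum_(1 <= k < (m + m).+1) (p ^ k <= m %% p ^ k + m %% p ^ k).
Proof.
move=> pp; apply/(@addIn (logn p m`! + logn p m`!)).
rewrite -lognM ?fact_gt0 // -lognM ?bin_gt0 ?leq_addr ?muln_gt0 ?fact_gt0 //.
have := @bin_fact (m + m) m (leq_addr _ _); rewrite addnK => ->.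
rewrite lognM ?fact_gt0 // (logn_fact_le pp (leqnn _)).
rewrite (logn_fact_le pp (leq_addr m m)) -!big_split /=.
by apply: eq_bigr => k _; rewrite divnD ?expn_gt0 ?prime_gt0 //; lia.
Qed.

(** Each carry contributes at most 1, and none occurs once [p ^ k > 2m]. *)
Lemma logn_central_bin_le (p m : nat) : prime p -> 0 < m ->
  p ^ logn p 'C(m + m, m) <= m + m.
Proof.
move=> pp m0; have p1 := prime_gt1 pp.
apply: leq_trans (trunc_logP p1 _); last by lia.
rewrite leq_exp2l // logn_central_bin //.
set t := trunc_log _ _.
have tm : t <= m + m.
  apply: leq_trans (trunc_logP p1 _); last by lia.
  exact/ltnW/ltn_expl.
rewrite (@big_cat_nat _ _ _ t.+1) //= [X in _ + X]big_nat_cond.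
rewrite [X in _ + X]big1 ?addn0; last first.
  move=> k /andP[/andP[tk _] _]; case: leqP => // h.
  have : p ^ k <= m + m by rewrite (leq_trans h) // leq_add // leq_mod.
  by move/(trunc_log_max p1); rewrite leqNgt tk.
apply: (@leq_trans (\sum_(1 <= k < t.+1) 1)); first by apply: leq_sum => k _; exact: leq_b1.
by rewrite sum_nat_const_nat muln1; lia.
Qed.

(** The central coefficient is the largest of the [2m + 1] coefficients, whose sum is [4 ^ m]. *)
Lemma central_bin_lower (m : nat) : 4 ^ m <= (m + m).+1 * 'C(m + m, m).
Proof.
have bin_le i : 'C(m + m, i) <= 'C(m + m, m).
  have step j : j < m -> 'C(m + m, j) <= 'C(m + m, j.+1).
    move=> jm; rewrite -(@leq_pmul2l j.+1) // mul_bin_left leq_mul2r; lia.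
  have low j : j <= m -> 'C(m + m, j) <= 'C(m + m, m).
    move=> jm; rewrite -(subKn jm); elim: (m - j) (leq_subr j m) => [|d IH] dm.
      by rewrite subn0.
    apply: leq_trans (IH (ltnW dm)); rewrite (_ : m - d = (m - d.+1).+1); last by lia.
    by apply: step; lia.
  case: (leqP i m) => [/low //|mi]; case: (leqP i (m + m)) => [i2|?]; last by rewrite bin_small.
  by rewrite -bin_sub // low //; lia.
have -> : 4 ^ m = \sum_(i < (m + m).+1) 'C(m + m, i).
  rewrite -[4]/(2 ^ 2) -expnM mul2n -addnn -[2]/(1 + 1) expnDn.
  by apply: eq_bigr => i _; rewrite !exp1n !muln1.
apply: (@leq_trans (\sum_(i < (m + m).+1) 'C(m + m, m))).
  by apply: leq_sum => i _; exact: bin_le.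
by rewrite sum_nat_const card_ord.
Qed.

(** The left side is a single term of the expansion of [(1 + 7) ^ (8k)]. *)
Lemma bin_upper (k : nat) : 'C(8 * k, 7 * k) * 7 ^ (7 * k) <= 8 ^ (8 * k).
Proof.
rewrite -[8 in X in _ <= X]/(1 + 7) expnDn.
have h : 7 * k < (8 * k).+1 by lia.
by rewrite (bigD1 (Ordinal h)) //= exp1n mul1n leq_addr.
Qed.

Lemma bin_prime_decomp (n m : nat) : m <= n ->
  'C(n, m) = \prod_(0 <= p < n.+1 | prime p) p ^ logn p 'C(n, m).
Proof.
move=> mn; have C0 : 0 < 'C(n, m) by rewrite bin_gt0.
rewrite -{1}(partnT C0) (@widen_partn ('C(n, m) + n)) ?leq_addr //.
rewrite (@big_cat_nat _ _ _ n.+1) //=; last by rewrite ltnS leq_addl.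
rewrite [X in _ * X]big_nat_cond [X in _ * X]big1 ?muln1; last first.
  move=> p /andP[/andP[np _] _]; case pp: (prime p); last by rewrite /logn pp.
  rewrite lognE C0 pp /=; case: ifP => // pC.
  have : p %| n`! by rewrite -(bin_fact mn) dvdn_mulr.
  by rewrite prime_dvd_fact // leqNgt np.
rewrite big_mkcond [RHS]big_mkcond; apply: eq_bigr => p _ /=.
by case: ifP => // pp; rewrite /logn pp.
Qed.

(* The three factors collect the primes up to v ^ 2, the other primes up to
   14k/3, which occur to the power at most 1, and those in (7k, 8k]; primes in
   (14k/3, 7k] do not divide the central binomial (Erdos). *)
Lemma central_bin_upper (k v : nat) : 0 < k -> 14 * k < v ^ 4 ->
  (forall p, prime p -> 8 * k < p <= 14 * k -> False) ->
  'C(7 * k + 7 * k, 7 * k) <=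
  (14 * k) ^ (v ^ 2).+1 * 4 ^ (14 * k %/ 3) * 'C(8 * k, 7 * k).
Proof.
move=> k0 vk noprime; set m := 7 * k; set C := 'C(m + m, m).
pose a p := if p <= v ^ 2 then 14 * k else 1.
pose b p := if p <= 14 * k %/ 3 then p else 1.
pose c p := if m < p <= 8 * k then p else 1.
have m0 : 0 < m by lia.
have C0 : 0 < C by rewrite bin_gt0 leq_addr.
apply: (@leq_trans (\prod_(0 <= p < (m + m).+1 | prime p) (a p * b p * c p))).
  rewrite {1}/C bin_prime_decomp ?leq_addr // big_nat_cond [X in _ <= X]big_nat_cond.
  apply: leq_prod => p /andP[/andP[_ pm] pp].
  have p0 := prime_gt0 pp; have p1 := prime_gt1 pp.
  have fle := logn_central_bin_le pp m0.
  have b0 : 0 < b p by rewrite /b; case: ifP.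
  have c0 : 0 < c p by rewrite /c; case: ifP.
  have a0 : 0 < a p by rewrite /a; case: ifP => //; lia.
  rewrite -/C.
  case: (leqP p (v ^ 2)) => pv.
    have -> : a p = 14 * k by rewrite /a pv.
    rewrite -mulnA; apply: leq_trans (leq_pmulr _ _); last by rewrite muln_gt0 b0.
    by apply: leq_trans fle _; rewrite /m; lia.
  (* Beyond [v ^ 2] the square of [p] exceeds [14k], which forces the exponent of [p] to be at most
     1. *)
  have p2 : 14 * k < p ^ 2.
    by apply: (ltn_trans vk); rewrite (_ : 4 = 2 * 2) // expnM ltn_exp2r.
  have e1 : logn p C <= 1.
    rewrite -ltnS -(@ltn_exp2l p) //; apply: leq_ltn_trans fle _.
    by rewrite /m; lia.
  have flep : p ^ logn p C <= p by rewrite -[X in _ <= X]expn1 leq_exp2l.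
  case: (leqP p (14 * k %/ 3)) => p3.
    have -> : b p = p by rewrite /b p3.
    by apply: leq_trans flep _; rewrite -mulnA mulnCA leq_pmulr // muln_gt0 a0.
  case: (leqP p m) => pm7; last first.
    have -> : c p = p.
      rewrite /c pm7 /=; case: leqP => // p8; case: (noprime p pp).
      by rewrite p8 /=; rewrite /m in pm; lia.
    by apply: leq_trans flep _; rewrite leq_pmull // muln_gt0 a0.
  (* For [14k/3 < p <= 7k] there is no carry: [m %% p = m - p] with [2 (m - p) < p], and higher
     powers of [p] exceed [2m]. *)
  suff -> : logn p C = 0 by rewrite expn0 !muln_gt0 a0 b0.
  rewrite logn_central_bin // big_nat_cond big1 // => i /andP[/andP[i0 im] _].
  case: leqP => //; case: i i0 im => // -[|i] _ _.
    rewrite expn1 (_ : m %% p = m - p); last first.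
      by rewrite -{1}(subnK pm7) modnDr modn_small //; rewrite /m in pm7 *; lia.
    by rewrite /m; rewrite /m in pm7; lia.
  have : p ^ 2 <= p ^ i.+2 by rewrite leq_exp2l.
  have := leq_mod m (p ^ i.+2); rewrite /m; lia.
rewrite !big_split /=; apply: leq_mul; first apply: leq_mul.
- rewrite -big_mkcondr /=.
  apply: (@leq_trans (\prod_(0 <= p < (m + m).+1 | p <= v ^ 2) (14 * k))).
    rewrite big_mkcond [X in _ <= X]big_mkcond; apply: leq_prod => p _.
    by case: (prime p); case: ifP => //= _; lia.
  rewrite big_const_seq iter_muln_1 leq_pexp2l //; first by lia.
  rewrite -size_filter -(size_iota 0 (v ^ 2).+1); apply: uniq_leq_size.
    by rewrite filter_uniq // iota_uniq.
  by move=> p; rewrite mem_filter mem_iota ltnS => /andP[].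
- rewrite -big_mkcondr /=.
  apply: leq_trans (primorial_le _).
  rewrite [X in _ <= X](@big_nat_widen _ _ _ _ _ (m + m).+1) /=; last by rewrite /m; lia.
  by apply/eq_leq/eq_bigl => p /=; rewrite ltnS.
- rewrite -big_mkcondr /=; apply: leq_prod_primes => [|p pp /andP[p1 p2]].
    by rewrite bin_gt0; lia.
  by apply: prime_dvd_bin; rewrite ?/m in p1 *; lia.
Qed.

(** Without such a prime, the two bounds on the central binomial give [k = O(v ^ 3)], while [v] is
    about the fourth root of [14k]. *)
Lemma prime_between (k : nat) : 400 ^ 4 <= k ->
  exists2 p, prime p & 8 * k < p <= 14 * k.
Proof.
move=> kbig; have k0 : 0 < k by apply: leq_trans kbig; rewrite expn_gt0.
case: (boolP (has (fun p => prime p && (8 * k < p <= 14 * k)) (iota 0 (14 * k).+1))).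
  by case/hasP => p _ /andP[pp pk]; exists p.
move=> /hasPn nop.
have noprime p : prime p -> 8 * k < p <= 14 * k -> False.
  move=> pp pk; have /nop : p \in iota 0 (14 * k).+1.
    by rewrite mem_iota /=; case/andP: pk.
  by rewrite pp pk.
have exv : exists v, 14 * k < v ^ 4.
  exists (14 * k).+1; apply: (@leq_ltn_trans ((14 * k) ^ 4)).
    by rewrite -[X in X <= _]expn1 leq_pexp2l //; lia.
  by rewrite ltn_exp2r.
have [v vk vmin] := ex_minnP exv.
have v400 : 400 < v.
  by rewrite -(@ltn_exp2r _ _ 4) //; apply: leq_ltn_trans vk; lia.
have {vmin} vk' : v.-1 ^ 4 <= 14 * k.
  by rewrite leqNgt; apply/negP => /vmin; lia.
have vv : v ^ 4 <= 2 ^ (4 * v).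
  by rewrite mulnC expnM leq_exp2r // ltnW // ltn_expl.
have up := central_bin_upper k0 vk noprime.
have lo := central_bin_lower (7 * k).
have bu := bin_upper k.
set B := 'C(8 * k, 7 * k) in bu up.
set q := 14 * k %/ 3 in up.
have q3 : q * 3 <= 14 * k by exact: leq_trunc_div.
have h1 : 4 ^ (7 * k) * 7 ^ (7 * k) <= (v ^ 4) ^ (v ^ 2).+2 * 4 ^ q * 8 ^ (8 * k).
  apply: leq_trans (leq_mul lo (leqnn _)) _.
  apply: leq_trans (leq_mul (leq_mul (leqnn _) up) (leqnn _)) _.
  rewrite !mulnA -[X in X <= _]mulnA; apply: leq_mul => //.
  apply: leq_mul => //; rewrite (expnS _ (v ^ 2).+1); apply: leq_mul.
    by apply: leq_trans vk; lia.
  by rewrite leq_exp2r // ltnW.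
(* Cubing removes the floor in [q]; the factor [4 ^ (14k)] then cancels against [4 ^ (21k)]. *)
have cube_le X V E : E = 8 ^ 24 ->
    (X ^ V * 4 ^ q * 8 ^ (8 * k)) ^ 3 <= 4 ^ (14 * k) * (X ^ (V * 3) * E ^ k).
  move=> EE; rewrite !expnMn -!expnM.
  rewrite (mulnC (X ^ _)) -!mulnA leq_mul //; first by rewrite leq_exp2l.
  by rewrite EE -expnM; apply: eq_leq; congr (_ * _ ^ _); lia.
have h2 : (4 ^ 7 * 7 ^ 21) ^ k <= (v ^ 4) ^ ((v ^ 2).+2 * 3) * (8 ^ 24) ^ k.
  rewrite -(@leq_pmul2l (4 ^ (14 * k))) ?expn_gt0 //.
  apply: (@leq_trans ((4 ^ (7 * k) * 7 ^ (7 * k)) ^ 3)).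
    rewrite (expnMn (4 ^ 7)) (expnMn (4 ^ (7 * k))) -!expnM mulnA -expnD.
    by apply: eq_leq; congr (_ ^ _ * _ ^ _); lia.
  apply: (@leq_trans (((v ^ 4) ^ (v ^ 2).+2 * 4 ^ q * 8 ^ (8 * k)) ^ 3)).
    by rewrite leq_exp2r.
  exact (cube_le (v ^ 4) (v ^ 2).+2 (8 ^ 24) (erefl (8 ^ 24))).
(* The ratio of the two bases is slightly below 2, so one squaring is enough to gain a factor 2 for
   each unit of [k]. *)
have num : 2 * (8 ^ 24) ^ 2 <= (4 ^ 7 * 7 ^ 21) ^ 2 by lia.
have Q0 : 0 < 8 ^ 24 by lia.
move: {cube_le} (4 ^ 7 * 7 ^ 21) (8 ^ 24) h2 num Q0 => P Q h2 num Q0.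
have h3 : 2 ^ k <= (v ^ 4) ^ ((v ^ 2).+2 * 3 * 2).
  rewrite -(@leq_pmul2r ((Q ^ 2) ^ k)) ?expn_gt0 ?Q0 // -expnMn.
  apply: (@leq_trans ((P ^ 2) ^ k)); first by rewrite leq_exp2r.
  rewrite expnAC (expnAC Q) (expnM (v ^ 4)) -expnMn leq_exp2r //.
have h4 : k <= 4 * v * ((v ^ 2).+2 * 3 * 2).
  rewrite -(@leq_exp2l 2) //; apply: leq_trans h3 _.
  by rewrite (expnM 2) leq_exp2r.
have h5 : v.-1 ^ 4 <= 336 * v ^ 3 + 672 * v by lia.
case: v v400 h5 {vk vk' vv up h1 h2 h3 h4} => // w w400 /= h5.
have : 399 * w ^ 3 <= w ^ 4 by rewrite (expnS w 3) leq_mul2r; lia.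
have : 399 * (399 * w) <= w ^ 3 by nia.
have : 399 * w ^ 2 <= w ^ 3 by nia.
nia.
Qed.

Local Open Scope ring_scope.

(** * The Frankl-Wilson bound *)

(** Vectors over {-1, 0, 1}, with [None] for 0 and [Some b] for the sign; [entry] reads them in any
    ring: int for products, ['F_p] for polynomials, the reals for geometry. *)
Definition signed_vec (n : nat) := {ffun 'I_n -> option bool}.
Definition entry (R : pzRingType) (o : option bool) : R :=
  if o is Some b then (-1) ^+ b else 0.
Arguments entry : clear implicits.
Definition supp (n : nat) (x : signed_vec n) : {set 'I_n} := [set i | isSome (x i)].
Definition dot (n : nat) (x y : signed_vec n) : int :=
  \sum_i entry int (x i) * entry int (y i).
Definition exponents (n D : nat) : {set {ffun 'I_n -> 'I_3}} :=
  [set e : {ffun 'I_n -> 'I_3} | (\sum_i e i <= D)%N].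

(** The [W] by [W] matrix of these sums is diagonal and invertible, yet it factors through a space
    of dimension [#|S|]. *)
Lemma diagonal_rank_bound (F : fieldType) (I E : finType) (S : {set E})
    (W : {set I}) (a : I -> E -> F) (b : E -> I -> F) :
  (forall x, x \in W -> \sum_(e in S) a x e * b e x != 0) ->
  (forall x y, x \in W -> y \in W -> x != y -> \sum_(e in S) a x e * b e y = 0) ->
  (#|W| <= #|S|)%N.
Proof.
move=> diag offdiag.
pose A : 'M[F]_(#|W|, #|S|) := \matrix_(i, k) a (enum_val i) (enum_val k).
pose B : 'M[F]_(#|S|, #|W|) := \matrix_(k, j) b (enum_val k) (enum_val j).
have ABE i j : (A *m B) i j =
    \sum_(e in S) a (enum_val i) e * b e (enum_val j).
  by rewrite mxE [RHS]big_enum_val /=; apply: eq_bigr => k _; rewrite !mxE.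
suff : A *m B \in unitmx by move/mxrank_unit <-; exact: mulmx_max_rank.
have -> : A *m B = diag_mx (\row_i (A *m B) i i).
  apply/matrixP => i j; rewrite [RHS]mxE [in RHS]mxE; case: eqVneq => [->|ij].
    by rewrite mulr1n.
  rewrite mulr0n ABE offdiag ?enum_valP //.
  by apply: contra_neq ij => /enum_val_inj.
rewrite unitmxE det_diag unitfE; apply/prodf_neq0 => i _.
by rewrite mxE ABE diag // enum_valP.
Qed.

(** * Functions of low degree on signed vectors *)

Section LowDegree.
Variables (F : comNzRingType) (n : nat).
Implicit Types (y : signed_vec n) (e : {ffun 'I_n -> 'I_3}).

Definition monomial e y : F := \prod_i entry F (y i) ^+ e i.

(** Stated for functions rather than formal polynomials, so that exponents may be reduced using
    values on {-1, 0, 1} only. *)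
Definition low_degree (D : nat) (g : signed_vec n -> F) : Prop :=
  exists c : {ffun 'I_n -> 'I_3} -> F,
    forall y, g y = \sum_(e in exponents n D) c e * monomial e y.

Lemma low_degreeS D D' g : (D <= D')%N -> low_degree D g -> low_degree D' g.
Proof.
move=> DD' [c gE]; exists (fun e => if e \in exponents n D then c e else 0) => y.
rewrite gE [LHS]big_mkcond [RHS]big_mkcond; apply: eq_bigr => e _ /=.
rewrite !inE; case: ifP => [h|_]; first by rewrite (leq_trans h DD').
by case: ifP; rewrite // mul0r.
Qed.

Lemma low_degree_cst D (a : F) : low_degree D (fun=> a).
Proof.
exists (fun e => if e == [ffun=> ord0] then a else 0) => y.
rewrite (bigD1 [ffun=> ord0]) /=; last first.
  by rewrite inE big1 // => i _; rewrite ffunE.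
rewrite eqxx big1 ?addr0 => [|e /andP[_ /negPf ->]]; last by rewrite mul0r.
by rewrite /monomial big1 ?mulr1 // => i _; rewrite ffunE expr0.
Qed.

Lemma low_degreeD D g h : low_degree D g -> low_degree D h ->
  low_degree D (fun y => g y + h y).
Proof.
move=> [c gE] [d hE]; exists (fun e => c e + d e) => y.
by rewrite gE hE -big_split; apply: eq_bigr => e _; rewrite mulrDl.
Qed.

Lemma low_degreeZ D a g : low_degree D g -> low_degree D (fun y => a * g y).
Proof.
move=> [c gE]; exists (fun e => a * c e) => y.
by rewrite gE mulr_sumr; apply: eq_bigr => e _; rewrite mulrA.
Qed.

Lemma low_degree_sum D (I : finType) (g : I -> signed_vec n -> F) :
  (forall i, low_degree D (g i)) -> low_degree D (fun y => \sum_i g i y).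
Proof.
move=> gD; elim: (index_enum I) => [|i r [c IH]].
  have [c cE] := low_degree_cst D 0.
  by exists c => y; rewrite big_nil; exact: cE.
have [d dE] : low_degree D (fun y => g i y + \sum_(j <- r) g j y).
  by apply: low_degreeD => //; exists c.
by exists d => y; rewrite big_cons dE.
Qed.

(* Entries satisfy t ^ 3 = t, so exponents above 2 can be reduced. *)
Definition raise (k : 'I_3) : 'I_3 := if k == 1%N :> nat then inord 2 else inord 1.

Lemma entry_raise (o : option bool) (k : 'I_3) : entry F o * entry F o ^+ k = entry F o ^+ raise k.
Proof.
rewrite /raise; case: k => -[|[|[|//]]] i /=; rewrite inordK //.
- by rewrite expr0 mulr1.
- by case: o => [b|]; rewrite /= ?mul0r // sqrr_sign mulr1.
Qed.

(** Only the exponent at [i] changes, by at most +1. Distinct monomials may merge after reduction,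
    so coefficients are summed over the fibres of [up]. *)
Lemma low_degree_entry D i g : low_degree D g ->
  low_degree D.+1 (fun y => entry F (y i) * g y).
Proof.
move=> [c gE].
pose up e := [ffun j => if j == i then raise (e j) else e j] : {ffun 'I_n -> 'I_3}.
exists (fun e' => \sum_(e in exponents n D | up e == e') c e) => y.
rewrite gE mulr_sumr (partition_big up (mem (exponents n D.+1))) /=; last first.
  move=> e; rewrite !inE (bigD1 i) //= [X in _ -> (X <= _)%N](bigD1 i) //= => eD.
  rewrite ffunE eqxx (eq_bigr (fun j => val (e j))) => [|j /negPf ji]; last first.
    by rewrite ffunE ji.
  apply: leq_trans (_ : ((e i).+1 + _ <= _)%N); last by rewrite addSn ltnS; exact: eD.
  rewrite leq_add2r /raise; case: (e i) => -[|[|[|//]]] ? /=; rewrite inordK //.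
apply: eq_bigr => e' _; rewrite mulr_suml; apply: eq_bigr => e /andP[_ /eqP <-].
rewrite mulrCA; congr (_ * _); rewrite /monomial (bigD1 i) //= [RHS](bigD1 i) //=.
rewrite mulrA entry_raise ffunE eqxx; congr (_ * _).
by apply: eq_bigr => j /negPf ji; rewrite ffunE ji.
Qed.

Lemma low_degree_affine_prod (m : nat) (u : 'I_n -> F) (a : nat -> F) :
  low_degree m (fun y => \prod_(0 <= k < m) (\sum_i u i * entry F (y i) - a k)).
Proof.
elim: m => [|m IH].
  have [c cE] := low_degree_cst 0 1.
  by exists c => y; rewrite big_geq //; exact: cE.
set g := fun y => _ in IH.
have [c cE] : low_degree m.+1
    (fun y => \sum_i u i * (entry F (y i) * g y) + - a m * g y).
  apply: low_degreeD; last by apply: low_degreeZ; exact: low_degreeS IH.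
  by apply: low_degree_sum => i; apply: low_degreeZ; exact: low_degree_entry.
exists c => y; rewrite -cE big_nat_recr //= mulrC mulrBl mulr_suml mulNr.
by congr (_ - _); apply: eq_bigr => i _; rewrite mulrA.
Qed.
End LowDegree.

Lemma dot_self n (x : signed_vec n) : dot x x = #|supp x|%:Z.
Proof.
rewrite -[RHS]natz -sum1_card natr_sum big_mkcond; apply: eq_bigr => i _.
by rewrite inE; case: (x i) => [b|] /=; rewrite ?mul0r // -expr2 sqrr_sign.
Qed.

(** Expand the squared norms of [x + y] and [x - y], both nonnegative; if the product is [j], the
    latter vanishes. *)
Lemma dot_bounds n j (x y : signed_vec n) : #|supp x| = j -> #|supp y| = j ->
  (- j%:Z <= dot x y <= j%:Z) /\ (dot x y = j -> x = y).
Proof.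
move=> xj yj; have xx := dot_self x; have yy := dot_self y.
pose e := entry int.
have sq s : \sum_i (e (x i) + s * e (y i)) ^+ 2 =
    dot x x + 2 * s * dot x y + s ^+ 2 * dot y y.
  rewrite /dot !mulr_sumr -!big_split; apply: eq_bigr => i _ /=.
  by rewrite -/(e (x i)) -/(e (y i)); ring.
have ge0 s : 0 <= \sum_i (e (x i) + s * e (y i)) ^+ 2.
  by apply: sumr_ge0 => i _; exact: sqr_ge0.
have := ge0 1; have := ge0 (-1); rewrite !sq xx yy xj yj => h1 h2.
split; first by lia.
move=> dj; have /eqP := sq (-1); rewrite xx yy xj yj dj.
have -> : j%:Z + 2 * -1 * j%:Z + (-1) ^+ 2 * j%:Z = 0 by ring.
rewrite psumr_eq0 => [/allP z|i _]; last exact: sqr_ge0.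
apply/ffunP => i; have := z i (mem_index_enum _).
rewrite sqrf_eq0 mulN1r subr_eq0 => /eqP; rewrite /e.
by case: (x i) (y i) => [[]|] [[]|].
Qed.

Lemma card_forbidden_dot (p n : nat) (W : {set signed_vec n}) : prime p ->
  (forall x, x \in W -> #|supp x| = p.-1) ->
  (forall x y, x \in W -> y \in W -> x != y -> dot x y != -1) ->
  (#|W| <= #|exponents n p.-1|)%N.
Proof.
move=> pp Wsupp Wdot; have p1 := prime_gt1 pp.
pose f (x y : signed_vec n) : 'F_p := \prod_(0 <= k < p.-1)
  (\sum_i entry 'F_p (x i) * entry 'F_p (y i) - k%:R).
have charp := pchar_Fp pp.
have dotF (x y : signed_vec n) : \sum_i entry 'F_p (x i) * entry 'F_p (y i) = (dot x y)%:~R.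
  rewrite /dot rmorph_sum; apply: eq_bigr => i _ /=.
  by rewrite rmorphM; case: (x i) (y i) => [[]|] [[]|].
have [c cE] : exists c, forall x y,
    f x y = \sum_(e in exponents n p.-1) c x e * monomial 'F_p e y.
  apply: (@fin_all_exists _ (fun _ => {ffun 'I_n -> 'I_3} -> 'F_p)
    (fun x c => forall y, f x y = \sum_(e in exponents n p.-1) c e * monomial 'F_p e y)) => x.
  exact: low_degree_affine_prod.
apply: (@diagonal_rank_bound 'F_p _ _ (exponents n p.-1) W c (@monomial 'F_p n)) => [x xW|x y xW yW xy].
  rewrite -cE /f dotF dot_self Wsupp // big_seq_cond.
  rewrite prodf_seq_neq0; apply/allP => k; rewrite mem_index_iota => /andP[_ kp].
  (* On the diagonal the factors are [p - 1 - k] with [k < p - 1], all nonzero modulo [p]. *)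
  apply/implyP => _; rewrite -[(Posz _)%:~R]/(p.-1%:R) -natrB ?(ltnW kp) //.
  by rewrite -(dvdn_pcharf charp) gtnNdvd //; lia.
rewrite -cE; apply/eqP; rewrite /f dotF prodf_seq_eq0.
have [/andP[lo hi] deq] := dot_bounds (Wsupp x xW) (Wsupp y yW).
have dneq : dot x y <> p.-1 by move=> /deq /eqP; rewrite (negPf xy).
have := Wdot x y xW yW xy; move: (dot x y) lo hi dneq {deq} => t lo hi tp /eqP t1.
(* The vanishing factor has index [t] when [0 <= t <= p - 2], and [t + p] when
   [-(p - 1) <= t <= -2]. *)
apply/hasP; case: (lerP 0 t) => t0.
  exists (absz t); first by rewrite mem_index_iota; lia.
  by rewrite /= -[(absz t)%:R]/((Posz (absz t))%:~R) gez0_abs // subrr.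
exists (absz (t + p%:Z)); first by rewrite mem_index_iota; lia.
rewrite /= -[(absz _)%:R]/((Posz (absz (t + p%:Z)))%:~R) gez0_abs; last by lia.
by rewrite rmorphD /= opprD addrA subrr sub0r oppr_eq0 -[_%:~R]/(p%:R) (pcharf0 charp).
Qed.

(** The right side is the generating function of total degree, and as [z <= 1] each exponent of
    degree at most [D] contributes at least [z ^+ D]. *)
Lemma card_exponents_bound (R : realFieldType) (n D : nat) (z : R) : 0 < z <= 1 ->
  #|exponents n D|%:R * z ^+ D <= (1 + z + z ^+ 2) ^+ n.
Proof.
move=> /andP[z0 z1].
have -> : (1 + z + z ^+ 2) ^+ n = \sum_(e : {ffun 'I_n -> 'I_3}) z ^+ (\sum_i e i)%N.
  transitivity (\prod_(i < n) \sum_(k : 'I_3) z ^+ k).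
    rewrite prodr_const card_ord; congr (_ ^+ _).
    by rewrite !big_ord_recl big_ord0 /= expr0 expr1 addr0 addrA.
  by rewrite bigA_distr_bigA /=; apply: eq_bigr => e _; rewrite expr_sum.
rewrite -sum1_card natr_sum mulr_suml big_mkcond /=; apply: ler_sum => e _.
rewrite inE mul1r; case: ifP => eD; last by rewrite exprn_ge0 // ltW.
by rewrite ler_wiXn2l // ltW.
Qed.

(** For each support [S] of size [j], the set [T] of negative coordinates can be any subset of
    [S]. *)
Lemma card_supp (n j : nat) : ('C(n, j) * 2 ^ j <= #|[set x : signed_vec n | #|supp x| == j]|)%N.
Proof.
rewrite -sum1_card (partition_big (@supp n) (fun S => #|S| == j)) /=; last first.
  by move=> x; rewrite inE.
rewrite -{1}[n]card_ord -card_draws -sum_nat_const.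
rewrite [X in (X <= _)%N](eq_bigl (fun S : {set 'I_n} => #|S| == j)) => [|S]; last by rewrite inE.
apply: leq_sum => S /eqP Sj.
pose h (T : {set 'I_n}) : signed_vec n := [ffun i => if i \in S then Some (i \in T) else None].
rewrite sum1_card -Sj -card_powerset -(@card_in_imset _ _ h); last first.
  move=> T T'; rewrite !inE => TS TS' /ffunP hT; apply/setP => i.
  have := hT i; rewrite !ffunE; case: ifP => [_ []//|iS _].
  by rewrite !(contraFF (fintype.subsetP _ i) iS).
apply/subset_leq_card/fintype.subsetP => _ /imsetP[T _ ->].
have hT : supp (h T) = S by apply/setP => i; rewrite inE ffunE; case: ifP.
by rewrite unfold_in /= inE hT Sj !eqxx.
Qed.

(** * Tensor squares and Borsuk partitions *)

(** Coordinates of a symmetric tensor: one from each pair (i, j), (j, i), hence dimension m(m + 1)/2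
    instead of m^2. *)
Local Notation upper_triangle m :=
  {ij : 'I_m * 'I_m | (ij.1 <= ij.2)%N}.

Lemma sum_upper_triangle (V : nmodType) (m : nat) (F : 'I_m * 'I_m -> V) :
  \sum_(t : upper_triangle m) F (val t) =
  \sum_(ij : 'I_m * 'I_m | (ij.1 <= ij.2)%N) F ij.
Proof.
by rewrite [RHS](reindex_omap (val : upper_triangle m -> _) insub) /=;
  [apply: eq_bigl => t; rewrite valK eqxx andbT; case: t | move=> ij h; rewrite insubT].
Qed.

Lemma sum_symmetric (V : nmodType) (m : nat) (F : 'I_m * 'I_m -> V) :
  (forall i j, F (i, j) = F (j, i)) ->
  \sum_ij F ij = \sum_(ij : 'I_m * 'I_m | (ij.1 <= ij.2)%N)
     F ij *+ (ij.1 != ij.2).+1.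
Proof.
move=> Fsym; rewrite (bigID (fun ij : 'I_m * 'I_m => (ij.1 <= ij.2)%N)) /=.
rewrite [RHS](eq_bigr (fun ij => F ij + F ij *+ (ij.1 != ij.2))); last first.
  by move=> ij _; rewrite mulrS.
rewrite big_split /=; congr (_ + _).
pose swap (ij : 'I_m * 'I_m) := (ij.2, ij.1).
have swapK : involutive swap by case.
rewrite (reindex_inj (inv_inj swapK)) /=.
rewrite big_mkcond [RHS]big_mkcond; apply: eq_bigr => -[i j] _ /=.
rewrite -val_eqE /= Fsym; case: (ltngtP i j) => //=.
Qed.

Lemma card_upper_triangle (m : nat) : (#|{: upper_triangle m}| * 2 = m * m.+1)%N.
Proof.
have cardE : (\sum_(t : upper_triangle m) 1 =
    \sum_(ij : 'I_m * 'I_m | (ij.1 <= ij.2)%N) 1)%N :=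
  @sum_upper_triangle nat m (fun=> 1%N).
rewrite -sum1_card cardE big_distrl /=.
rewrite (eq_bigr (fun ij => (ij.1 != ij.2).+1 + (ij.1 == ij.2)))%N; last first.
  by move=> ij _; case: eqP.
rewrite big_split /=.
have : (\sum_(ij : 'I_m * 'I_m) 1 =
    \sum_(ij : 'I_m * 'I_m | (ij.1 <= ij.2)%N) (ij.1 != ij.2).+1)%N.
  rewrite [LHS](@sum_symmetric nat m (fun=> 1%N)) //.
  by apply: eq_bigr => ij _; rewrite natn.
rewrite sum1_card card_prod card_ord.
rewrite mulnS addnC => <-; congr addn.
transitivity (\sum_(i < m) \sum_(j < m) (i == j))%N; last first.
  rewrite -[RHS]card_ord -sum1_card; apply: eq_bigr => i _.
  by rewrite (bigD1 i) //= eqxx big1 // => j; rewrite eq_sym => /negPf ->.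
rewrite pair_big big_mkcond /=; apply: eq_bigr => -[i j] _ /=.
by rewrite -val_eqE /=; case: ltngtP.
Qed.

Lemma euclidean_realization (R : realType) (I : finType) (d : nat) : (#|I| <= d)%N ->
  exists phi : (I -> R) -> 'rV[R]_d, forall f g,
    euclidean_dist (phi f) (phi g) = Num.sqrt (\sum_i (f i - g i) ^+ 2).
Proof.
move=> Id; pose h (i : I) : 'I_d := widen_ord Id (enum_rank i).
have hinj : injective h.
  by move=> i j /(congr1 val) /= ij; apply/enum_rank_inj/val_inj.
(* Coordinates outside the image of [h] get the empty sum 0. *)
exists (fun f => \row_k \sum_(i | h i == k) f i) => f g.
rewrite /euclidean_dist; congr Num.sqrt.
rewrite [RHS](eq_bigr (fun i => \sum_(k | h i == k) (f i - g i) ^+ 2)); last first.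
  by move=> i _; rewrite (eq_bigl (pred1 (h i))) ?big_pred1_eq // => k; rewrite eq_sym.
rewrite [RHS](exchange_big_dep predT) //=; apply: eq_bigr => k _.
rewrite !mxE -sumrB.
case: (pickP (fun i => h i == k)) => [i /eqP hik|no]; last first.
  by rewrite !big_pred0 // expr0n.
by rewrite !(big_pred1 i) // => j; rewrite -hik (inj_eq hinj).
Qed.

(** The right side is the distance between the tensor squares of [u] and [v]. *)
Lemma tensor_square_embedding (R : realType) (m d : nat) : (m * m.+1 <= 2 * d)%N ->
  exists psi : ('I_m -> R) -> 'rV[R]_d, forall u v,
    euclidean_dist (psi u) (psi v) =
    Num.sqrt ((\sum_i u i ^+ 2) ^+ 2 + (\sum_i v i ^+ 2) ^+ 2
              - 2 * (\sum_i u i * v i) ^+ 2).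
Proof.
move=> md; have cd : (#|{: upper_triangle m}| <= d)%N.
  by have := card_upper_triangle m; lia.
have [phi phiE] := euclidean_realization R cd.
(* The weight sqrt 2 off the diagonal makes up for storing each symmetric pair once. *)
pose w (ij : 'I_m * 'I_m) : R := Num.sqrt (ij.1 != ij.2).+1%:R.
exists (fun u => phi (fun t => w (val t) * (u (val t).1 * u (val t).2))) => u v.
rewrite phiE; congr Num.sqrt.
rewrite (sum_upper_triangle (fun ij => (w ij * (u ij.1 * u ij.2) - w ij * (v ij.1 * v ij.2)) ^+ 2)).
rewrite (eq_bigr (fun ij => (u ij.1 * u ij.2 - v ij.1 * v ij.2) ^+ 2 *+ (ij.1 != ij.2).+1)); last first.
  by move=> ij _; rewrite -mulrBr exprMn sqr_sqrtr ?ler0n // mulr_natl.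
rewrite -sum_symmetric => [|i j]; last by rewrite /= [u i * _]mulrC [v i * _]mulrC.
rewrite -(pair_big xpredT xpredT (fun i j => (u i * u j - v i * v j) ^+ 2)) /=.
have sq (f : 'I_m -> R) : (\sum_i f i) ^+ 2 = \sum_i \sum_j f i * f j.
  by rewrite expr2 mulr_suml; apply: eq_bigr => i _; rewrite mulr_sumr.
rewrite !sq mulr_sumr -big_split -sumrB /=; apply: eq_bigr => i _.
rewrite mulr_sumr -big_split -sumrB /=; apply: eq_bigr => j _; ring.
Qed.

Lemma borsuk_bound_card (R : realType) (d N p n : nat) : prime p ->
  (n.+1 * n.+2 <= 2 * d)%N -> borsuk_bound R d N ->
  (#|exponents n p.-1| < #|[set x : signed_vec n | #|supp x| == p.-1]|)%N ->
  (#|[set x : signed_vec n | #|supp x| == p.-1]| <= N * #|exponents n p.-1|)%N.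
Proof.
move=> pp nd [_ borsuk]; set V := [set x | _]; set M := #|exponents _ _| => MV.
have p0 := prime_gt0 pp.
have [psi psiE] := tensor_square_embedding R nd.
(* The squared distance is [2 c^4 (p^2 - <x', y'>^2)]; this [c] satisfies [2 c^4 p^2 = 1], which
   normalises the diameter to 1. *)
pose c : R := Num.sqrt (Num.sqrt 2 * p%:R)^-1.
have c2 : c ^+ 2 = (Num.sqrt 2 * p%:R)^-1.
  by rewrite sqr_sqrtr // invr_ge0 mulr_ge0 ?ler0n ?sqrtr_ge0.
pose u (x : signed_vec n) (i : 'I_n.+1) : R :=
  c * (if unlift ord0 i is Some k then entry R (x k) else 1).
have udot x y : \sum_i u x i * u y i = c ^+ 2 * (1 + dot x y)%:~R.
  rewrite big_ord_recl /u unlift_none mulr1 -expr2 rmorphD /= mulrDr mulr1; congr (_ + _).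
  rewrite /dot rmorph_sum mulr_sumr; apply: eq_bigr => i _ /=.
  rewrite liftK mulrACA -expr2 rmorphM; congr (_ * (_ * _)).
    by case: (x i) => [[]|].
  by case: (y i) => [[]|].
have unorm x : x \in V -> \sum_i u x i ^+ 2 = c ^+ 2 * p%:R.
  rewrite inE => /eqP xp; rewrite (udot x x) dot_self xp; congr (_ * _).
  by rewrite -[in RHS](prednK p0) -[(1 + _)%R]/(Posz (1 + p.-1)) add1n.
pose phi x := psi (u x).
have distE x y : x \in V -> y \in V ->
    euclidean_dist (phi x) (phi y) = Num.sqrt (1 - ((1 + dot x y)%:~R / p%:R) ^+ 2).
  move=> xV yV; rewrite psiE udot !unorm // c2; congr Num.sqrt.
  have s2 : Num.sqrt 2 ^+ 2 = 2 :> R by rewrite sqr_sqrtr // ler0n.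
  have s0 : Num.sqrt 2 != 0 :> R by rewrite gt_eqF // sqrtr_gt0 ltr0n.
  have pn0 : p%:R != 0 :> R by rewrite pnatr_eq0 -lt0n.
  rewrite invfM !exprMn !exprVn s2; field => //.
have dist_le1 x y : x \in V -> y \in V -> euclidean_dist (phi x) (phi y) <= 1.
  move=> xV yV; rewrite distE // -[leRHS]sqrtr1 ler_wsqrtr // gerBl //.
  exact: sqr_ge0.
have dist_eq1 x y : x \in V -> y \in V -> dot x y = -1 ->
    euclidean_dist (phi x) (phi y) = 1.
  by move=> xV yV xy; rewrite distE // xy addrN mul0r expr0n subr0 sqrtr1.
have indep (W : {set signed_vec n}) : W \subset V ->
    (forall x y, x \in W -> y \in W -> euclidean_dist (phi x) (phi y) < 1) ->
    (#|W| <= M)%N.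
  move=> /fintype.subsetP WV W1; apply: card_forbidden_dot => // [x /WV|x y xW yW _].
    by rewrite inE => /eqP.
  apply/eqP => /(dist_eq1 _ _ (WV _ xW) (WV _ yW)) d1.
  by have := W1 x y xW yW; rewrite d1 ltxx.
pose A : set 'rV[R]_d := [set phi x | x in [set x | x \in V]]%classic.
have diamA : diameter A = 1%:E.
  apply/eqP; rewrite eq_le; apply/andP; split.
    apply: ge_ereal_sup => _ [_ [x xV <-] [_ [y yV <-] <-]].
    by rewrite lee_fin dist_le1.
  (* The distance 1 is attained: otherwise all of [V] would obey the Frankl-Wilson bound, against
     [MV]. *)
  have [x [y [xV yV xy]]] : exists x y, [/\ x \in V, y \in V & dot x y = -1].
    apply: contrapT => no; move: MV; rewrite ltnNge => /negP; apply.
    apply: card_forbidden_dot => // [x|x y xV yV _]; first by rewrite inE => /eqP.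
    by apply/eqP => xy; apply: no; exists x, y.
  apply: ereal_sup_ubound; exists (phi x); first by exists x.
  by exists (phi y); [exists y | rewrite dist_eq1].
have [P [PA _ Pdiam]] := borsuk A diamA.
pose W i := [set x in V | `[< P i (phi x) >]].
apply: (@leq_trans #|\bigcup_(i < N) W i|).
  apply/subset_leq_card/fintype.subsetP => x xV.
  have : A (phi x) by exists x.
  rewrite -PA => -[i _ Pi]; apply/bigcupP; exists i => //.
  by rewrite inE xV; apply/asboolP.
rewrite -[N in X in (_ <= X)%N]card_ord -sum_nat_const.
apply: (big_ind2 (fun (B : {set _}) s => #|B| <= s)%N) => [|B s B' s' Bs Bs'|i _].
- by rewrite cards0.
- by rewrite cardsU (leq_trans (leq_subr _ _)) // leq_add.
apply: indep => [|x y].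
  by apply/fintype.subsetP => x; rewrite inE => /andP[].
rewrite !inE => /andP[_ /asboolP Px] /andP[_ /asboolP Py].
rewrite -lte_fin; apply: le_lt_trans (Pdiam i).
by apply: ereal_sup_ubound; exists (phi x) => //; exists (phi y).
Qed.

(** * Numerical estimates *)

Section WeightedBinomial.
Variables (R : realFieldType) (n : nat) (w : R).
Hypothesis w0 : 0 < w.

Let f i := 'C(n, i)%:R * w ^+ i.

(** The quotient of consecutive terms, [w (n - i) / (i + 1)], decreases in [i]; monotonicity and
    unimodality rest on this. *)
Let f_ratio i : i.+1%:R * f i.+1 = w * (n - i)%:R * f i.
Proof.
rewrite /f exprS mulrA -natrM mul_bin_left natrM; ring.
Qed.

Let f_ge0 i : 0 <= f i.
Proof. by rewrite mulr_ge0 ?ler0n // exprn_ge0 // ltW. Qed.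

Lemma binomial_term_incr (a j : nat) : (a <= j)%N ->
  (forall i, (i < j)%N -> i.+1%:R <= w * (n - i)%:R) -> f a <= f j.
Proof.
move=> /subnKC <-; elim: (j - a)%N => [|m IH] up; first by rewrite addn0.
apply: le_trans (IH _) _ => [i im|]; first by apply: up; rewrite addnS ltnS ltnW.
rewrite addnS -(ler_pM2l (ltr0Sn R (a + m))) f_ratio ler_wpM2r // up //.
by rewrite addnS.
Qed.

Lemma binomial_term_decr (j b : nat) : (j <= b)%N ->
  (forall i, (j <= i)%N -> w * (n - i)%:R <= i.+1%:R) -> f b <= f j.
Proof.
move=> /subnKC <- down; elim: (b - j)%N => [|m IH]; first by rewrite addn0.
apply: le_trans IH; rewrite addnS -(ler_pM2l (ltr0Sn R (j + m))) f_ratio.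
by rewrite ler_wpM2r // down // leq_addr.
Qed.

(** If the quotient at [j] is at most 1, the terms decrease from [j] on; otherwise they increase up
    to [j]. Lower bounds on an interval thus reduce to its ends. *)
Lemma binomial_term_unimodal (a j b : nat) : (a <= j <= b)%N ->
  f a <= f j \/ f b <= f j.
Proof.
move=> /andP[aj jb]; case: (lerP (w * (n - j)%:R) j.+1%:R) => h; [right|left].
  apply: binomial_term_decr => // i ji; apply: (@le_trans _ _ (w * (n - j)%:R)).
    by rewrite ler_pM2l // ler_nat leq_sub2l.
  by apply: le_trans h _; rewrite ler_nat.
apply: binomial_term_incr => // i ij; apply: (@le_trans _ _ (w * (n - j)%:R)).
  by apply: le_trans (ltW h); rewrite ler_nat; exact: ltnW.
by rewrite ler_pM2l // ler_nat leq_sub2l // ltnW.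
Qed.

(** The hypothesis places [a] at [n w / (1 + w)], where the largest of the [n + 1] terms of
    [(1 + w) ^+ n] sits. *)
Lemma binomial_peak (a : nat) : w * (n - a)%:R = a%:R ->
  (1 + w) ^+ n <= n.+1%:R * f a.
Proof.
move=> wa; have peak i : f i <= f a.
  case: (leqP i a) => [ia|/ltnW ai].
    apply: binomial_term_incr => // k ka.
    apply: (@le_trans _ _ a%:R); first by rewrite ler_nat.
    by rewrite -wa ler_pM2l // ler_nat leq_sub2l // ltnW.
  apply: binomial_term_decr => // k ak; apply: (@le_trans _ _ a%:R).
    by rewrite -wa ler_pM2l // ler_nat leq_sub2l.
  by rewrite ler_nat ltnW.
rewrite exprDn mulr_natl -[n.+1 in leRHS]card_ord -sumr_const.
by apply: ler_sum => i _; rewrite expr1n mul1r -mulr_natl; exact: peak.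
Qed.
End WeightedBinomial.

(** With [(1 + e)^2 <= q], squaring Bernoulli's inequality gives quadratic growth, which beats any
    linear function. *)
Lemma linear_le_exp (R : archiRealFieldType) (q C : R) : 1 < q -> 0 <= C ->
  exists K : nat, forall k : nat, (K <= k)%N -> C * k.+1%:R <= q ^+ k.
Proof.
move=> q1 C0.
have [e e0 eq] : exists2 e : R, 0 < e & (1 + e) ^+ 2 <= q.
  pose m := Num.min (q - 1) 1; exists (m / 3).
    by rewrite divr_gt0 // lt_min subr_gt0 q1 ltr01.
  have m1 : m <= 1 by rewrite ge_min lexx orbT.
  have m2 : m <= q - 1 by rewrite ge_min lexx.
  have m0 : 0 < m by rewrite lt_min subr_gt0 q1 ltr01.
  nra.
have bernoulli k : 1 + k%:R * e <= (1 + e) ^+ k.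
  elim: k => [|k IH]; first by rewrite mul0r addr0 expr0.
  rewrite exprS; apply: (@le_trans _ _ ((1 + e) * (1 + k%:R * e))).
    have : 0 <= k%:R :> R by rewrite ler0n.
    by rewrite -natr1; nra.
  by rewrite ler_pM2l // addr_gt0.
(* Chosen so that [C (k + 1) <= B (1 + k e)]. *)
pose B := C + C / e.
have B0 : 0 <= B by rewrite addr_ge0 // divr_ge0 // ltW.
exists (Num.truncn (B / e)).+1 => k Kk.
have Bk : B <= 1 + k%:R * e.
  apply: (@le_trans _ _ (k%:R * e)); last by rewrite lerDr.
  rewrite -ler_pdivrMr // ltW // (lt_le_trans (truncnS_gt _)) //.
  by rewrite ler_nat.
apply: (@le_trans _ _ ((1 + k%:R * e) ^+ 2)); last first.
  apply: (@le_trans _ _ (((1 + e) ^+ k) ^+ 2)).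
    by rewrite lerXn2r ?nnegrE ?exprn_ge0 ?addr_ge0 ?mulr_ge0 ?ler0n ?(ltW e0) ?bernoulli.
  have q0 : 0 <= q := ltW (lt_trans ltr01 q1).
  by rewrite -exprM mulnC exprM lerXn2r ?nnegrE ?exprn_ge0 ?addr_ge0 ?(ltW e0).
apply: (@le_trans _ _ (B * (1 + k%:R * e))); last first.
  by rewrite expr2 ler_wpM2r // (le_trans B0).
rewrite /B mulrDl -natr1.
have -> : C / e * (1 + k%:R * e) = C / e + C * k%:R by field; rewrite gt_eqF.
have h1 : 0 <= C / e by rewrite divr_ge0 // ltW.
have h2 : 0 <= C * (k%:R * e) by rewrite !mulr_ge0 // ltW.
nra.
Qed.

(** With [w = c / (L - c)] the index [c k] is the peak, so the binomial is known up to the factor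
    [L k + 1]. One comparison for [k = 1] with a spare factor [q] then suffices, as [q ^+ k] absorbs
    the rest. *)
Lemma endpoint_bound (R : realFieldType) (g w z : R) (L c k : nat) :
  0 < g -> 0 < w -> 0 < z -> w * (L - c)%:R = c%:R ->
  forall q : R, 0 < q ->
  q * (g * (1 + z + z ^+ 2)) ^+ L <= (1 + w) ^+ L * (2 * z / w) ^+ c ->
  (L * k).+1%:R * g ^+ (L + 2) <= q ^+ k ->
  (1 + z + z ^+ 2) ^+ (L * k) * g ^+ (L * k + (L + 2))
    <= 'C(L * k, c * k)%:R * (2 * z) ^+ (c * k).
Proof.
move=> g0 w0 z0 wc q q0 num big.
set Q := 1 + z + z ^+ 2 in num *.
have Q0 : 0 < Q by rewrite /Q addr_gt0 ?exprn_gt0 // addr_gt0.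
have := @binomial_peak _ (L * k) w w0 (c * k).
rewrite -mulnBl !natrM mulrA wc => /(_ erefl) peak.
have h1 : q ^+ k * (g * Q) ^+ (L * k) <= (1 + w) ^+ (L * k) * (2 * z / w) ^+ (c * k).
  rewrite !exprM -!exprMn lerXn2r ?nnegrE //.
    by rewrite ltW // mulr_gt0 // exprn_gt0 // mulr_gt0.
  by rewrite ltW // mulr_gt0 // exprn_gt0 // ?addr_gt0 // ?divr_gt0 // mulr_gt0.
rewrite -(ler_pM2l (ltr0Sn R (L * k))).
apply: (@le_trans _ _ (q ^+ k * (g * Q) ^+ (L * k))).
  have -> : (L * k).+1%:R * (Q ^+ (L * k) * g ^+ (L * k + (L + 2))) =
      (L * k).+1%:R * g ^+ (L + 2) * (g * Q) ^+ (L * k).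
    by rewrite exprD exprMn; ring.
  by rewrite ler_wpM2r // exprn_ge0 // ltW // mulr_gt0.
apply: le_trans h1 _.
have wz0 : 0 <= (2 * z / w) ^+ (c * k).
  by rewrite exprn_ge0 // ltW // divr_gt0 // mulr_gt0.
apply: le_trans (ler_wpM2r wz0 peak) _.
rewrite -!mulrA -exprMn (_ : w * (2 * (z / w)) = 2 * z) //.
by field; rewrite gt_eqF.
Qed.

(** Reduces the comparison required by [endpoint_bound], for [q = 201/200], to integer
    arithmetic. *)
Lemma cleared_denominators (R : realFieldType) (m c a b s t u v : nat) :
  (0 < b)%N -> (0 < t)%N -> (0 < v)%N ->
  (201 * (u ^ m * (b ^ m * t ^ c)) <= 200 * (a ^ m * s ^ c * v ^ m))%N ->
  (201%:R / 200%:R : R) * (u%:R / v%:R) ^+ m <= (a%:R / b%:R) ^+ m * (s%:R / t%:R) ^+ c.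
Proof.
move=> b0 t0 v0; rewrite -(ler_nat R) !natrM !natrX => h.
rewrite !expr_div_n mulf_div mulf_div.
rewrite ler_pdivrMr ?mulr_gt0 ?exprn_gt0 ?ltr0n //.
rewrite [leRHS]mulrAC ler_pdivlMr ?mulr_gt0 ?exprn_gt0 ?ltr0n //.
rewrite -!mulrA in h *; rewrite (mulrC (_ ^+ m) (_ * _)) -!mulrA in h *.
by apply: le_trans h _; rewrite le_eqVlt; apply/orP; left; apply/eqP; ring.
Qed.

Lemma weighted_family_bound (R : archiRealFieldType) : exists K : nat, forall k j : nat,
  (K <= k)%N -> (8 * k <= j <= 14 * k)%N ->
  exists2 z : R, 0 < z <= 1 &
    (1 + z + z ^+ 2) ^+ (26 * k) * (33%:R / 29%:R) ^+ (26 * k + 28)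
    <= 'C(26 * k, j)%:R * (2 * z) ^+ j.
Proof.
(* 33/29 is slightly above 1.2 ^ (1 / sqrt 2), and 201/200 is the growth rate
   left over in each of the four comparisons [num] below.  The term in j is
   unimodal, so only the ends of [8k, 11k] and [11k, 14k] matter; z = 2/7 and
   z = 3/7 are near-optimal on these two ranges. *)
set g : R := 33%:R / 29%:R; pose q : R := 201%:R / 200%:R.
have g0 : 0 < g by rewrite divr_gt0 ?ltr0n.
have q1 : 1 < q by rewrite ltr_pdivlMr ?ltr0n // mul1r ltr_nat.
have q0 : 0 < q by exact: lt_trans q1.
have [K bigK] := @linear_le_exp R q (26 * g ^+ 28) q1 (mulr_ge0 (ler0n _ _) (exprn_ge0 _ (ltW g0))).
exists K => k j /bigK big /andP[j8 j14].
have {}big : (26 * k).+1%:R * g ^+ (26 + 2) <= q ^+ k.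
  apply: le_trans big; rewrite mulrAC ler_wpM2r ?exprn_ge0 ?(ltW g0) //.
  by rewrite -natrM ler_nat; lia.
have z2 : 0 < 2%:R / 7%:R :> R by rewrite divr_gt0 ?ltr0n.
have z3 : 0 < 3%:R / 7%:R :> R by rewrite divr_gt0 ?ltr0n.
have Q2 : g * (1 + 2%:R / 7%:R + (2%:R / 7%:R) ^+ 2) = (33 * 67)%:R / (29 * 49)%:R.
  by rewrite /g !natrM; field.
have Q3 : g * (1 + 3%:R / 7%:R + (3%:R / 7%:R) ^+ 2) = (33 * 79)%:R / (29 * 49)%:R.
  by rewrite /g !natrM; field.
(* The peak weights [c / (26 - c)] for [c] = 8, 11, 14. *)
have w8 : 0 < 4%:R / 9%:R :> R by rewrite divr_gt0 ?ltr0n.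
have w11 : 0 < 11%:R / 15%:R :> R by rewrite divr_gt0 ?ltr0n.
have w14 : 0 < 7%:R / 6%:R :> R by rewrite divr_gt0 ?ltr0n.
have low8 : (1 + 2%:R / 7%:R + (2%:R / 7%:R) ^+ 2) ^+ (26 * k) * g ^+ (26 * k + (26 + 2))
    <= 'C(26 * k, 8 * k)%:R * (2 * (2%:R / 7%:R)) ^+ (8 * k).
  apply: (@endpoint_bound R g (4%:R / 9%:R) (2%:R / 7%:R) 26 8 k g0 w8 z2 _ q q0 _ big).
    by rewrite (_ : (26 - 8)%N = 18) //; field.
  rewrite Q2.
  have -> : 1 + 4%:R / 9%:R = 13%:R / 9%:R :> R by field.
  have -> : 2 * (2%:R / 7%:R) / (4%:R / 9%:R) = 9%:R / 7%:R :> R by field.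
  have num : (201 * ((33 * 67) ^ 26 * (9 ^ 26 * 7 ^ 8)) <=
      200 * (13 ^ 26 * 9 ^ 8 * (29 * 49) ^ 26))%N.
    by clear; lia.
  exact: (@cleared_denominators R 26 8 13 9 9 7 (33 * 67) (29 * 49) isT isT isT num).
have low11 : (1 + 2%:R / 7%:R + (2%:R / 7%:R) ^+ 2) ^+ (26 * k) * g ^+ (26 * k + (26 + 2))
    <= 'C(26 * k, 11 * k)%:R * (2 * (2%:R / 7%:R)) ^+ (11 * k).
  apply: (@endpoint_bound R g (11%:R / 15%:R) (2%:R / 7%:R) 26 11 k g0 w11 z2 _ q q0 _ big).
    by rewrite (_ : (26 - 11)%N = 15) //; field.
  rewrite Q2.
  have -> : 1 + 11%:R / 15%:R = 26%:R / 15%:R :> R by field.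
  have -> : 2 * (2%:R / 7%:R) / (11%:R / 15%:R) = 60%:R / 77%:R :> R by field.
  have num : (201 * ((33 * 67) ^ 26 * (15 ^ 26 * 77 ^ 11)) <=
      200 * (26 ^ 26 * 60 ^ 11 * (29 * 49) ^ 26))%N.
    by clear; lia.
  exact: (@cleared_denominators R 26 11 26 15 60 77 (33 * 67) (29 * 49) isT isT isT num).
have high11 : (1 + 3%:R / 7%:R + (3%:R / 7%:R) ^+ 2) ^+ (26 * k) * g ^+ (26 * k + (26 + 2))
    <= 'C(26 * k, 11 * k)%:R * (2 * (3%:R / 7%:R)) ^+ (11 * k).
  apply: (@endpoint_bound R g (11%:R / 15%:R) (3%:R / 7%:R) 26 11 k g0 w11 z3 _ q q0 _ big).
    by rewrite (_ : (26 - 11)%N = 15) //; field.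
  rewrite Q3.
  have -> : 1 + 11%:R / 15%:R = 26%:R / 15%:R :> R by field.
  have -> : 2 * (3%:R / 7%:R) / (11%:R / 15%:R) = 90%:R / 77%:R :> R by field.
  have num : (201 * ((33 * 79) ^ 26 * (15 ^ 26 * 77 ^ 11)) <=
      200 * (26 ^ 26 * 90 ^ 11 * (29 * 49) ^ 26))%N.
    by clear; lia.
  exact: (@cleared_denominators R 26 11 26 15 90 77 (33 * 79) (29 * 49) isT isT isT num).
have high14 : (1 + 3%:R / 7%:R + (3%:R / 7%:R) ^+ 2) ^+ (26 * k) * g ^+ (26 * k + (26 + 2))
    <= 'C(26 * k, 14 * k)%:R * (2 * (3%:R / 7%:R)) ^+ (14 * k).
  apply: (@endpoint_bound R g (7%:R / 6%:R) (3%:R / 7%:R) 26 14 k g0 w14 z3 _ q q0 _ big).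
    by rewrite (_ : (26 - 14)%N = 12) //; field.
  rewrite Q3.
  have -> : 1 + 7%:R / 6%:R = 13%:R / 6%:R :> R by field.
  have -> : 2 * (3%:R / 7%:R) / (7%:R / 6%:R) = 36%:R / 49%:R :> R by field.
  have num : (201 * ((33 * 79) ^ 26 * (6 ^ 26 * 49 ^ 14)) <=
      200 * (13 ^ 26 * 36 ^ 14 * (29 * 49) ^ 26))%N.
    by clear; lia.
  exact: (@cleared_denominators R 26 14 13 6 36 49 (33 * 79) (29 * 49) isT isT isT num).
have zw m : 0 < m%:R / 7%:R :> R -> 0 < 2 * (m%:R / 7%:R) :> R by move=> h; rewrite mulr_gt0.
case: (leqP j (11 * k)) => j11; [exists (2%:R / 7%:R)|exists (3%:R / 7%:R)].
- by rewrite z2 ler_pdivrMr ?ltr0n // mul1r ler_nat.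
- have [] := @binomial_term_unimodal R (26 * k) _ (zw 2 z2) (8 * k) j (11 * k).
  + by rewrite j8.
  + exact: le_trans.
  + exact: le_trans.
- by rewrite z3 ler_pdivrMr ?ltr0n // mul1r ler_nat.
- have [] := @binomial_term_unimodal R (26 * k) _ (zw 3 z3) (11 * k) j (14 * k).
  + by rewrite (ltnW j11).
  + exact: le_trans.
  + exact: le_trans.
Qed.

(** 99/140, half the convergent 99/70 of sqrt 2, lies just above 1/sqrt 2; raising to the power 140
    leaves an inequality between integers. *)
Lemma powR_sqrt_le (R : realType) (d m : nat) : (2 * d <= m ^ 2)%N ->
  (12%:R / 10%:R : R) `^ Num.sqrt (d%:R : R) <= (33%:R / 29%:R) ^+ m.
Proof.
move=> dm; set a : R := 12%:R / 10%:R.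
have a1 : 1 <= a by rewrite ler_pdivlMr ?ltr0n // mul1r ler_nat.
have a0 : 0 <= a by exact: le_trans a1.
have sqrt_le : Num.sqrt (d%:R : R) <= 99%:R / 140%:R * m%:R.
  have m0 : 0 <= 99%:R / 140%:R * m%:R :> R by rewrite mulr_ge0 ?divr_ge0 ?ler0n.
  rewrite -(ger0_norm m0) -sqrtr_sqr ler_wsqrtr //.
  have : (2 * d)%:R <= (m ^ 2)%:R :> R by rewrite ler_nat.
  by rewrite natrM natrX => h; have := sqr_ge0 (m%:R : R); lra.
apply: le_trans (ler_powR a1 sqrt_le) _.
rewrite powRrM powR_mulrn ?powR_ge0 // lerXn2r ?nnegrE ?powR_ge0 ?divr_ge0 ?ler0n //.
rewrite -(@ler_pXn2r _ 140) ?nnegrE ?powR_ge0 ?divr_ge0 ?ler0n //.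
rewrite -powR_mulrn ?powR_ge0 // -powRrM mulfVK ?pnatr_eq0 // powR_mulrn //.
have -> : a = 6%:R / 5%:R by rewrite /a; field.
rewrite !expr_div_n ler_pdivrMr ?exprn_gt0 ?ltr0n // mulrAC ler_pdivlMr ?exprn_gt0 ?ltr0n //.
have num : (6 ^ 99 * 29 ^ 140 <= 33 ^ 140 * 5 ^ 99)%N by clear; lia.
have lift (x y s t i j : nat) : (x ^ i * y ^ j <= s ^ j * t ^ i)%N ->
    x%:R ^+ i * y%:R ^+ j <= s%:R ^+ j * t%:R ^+ i :> R.
  by rewrite -(ler_nat R) !natrM !natrX.
exact: (lift 6 29 33 5 99 140 num).
Qed.

(** * Choice of the parameters and conclusion *)

Theorem theorem1 (R : realType) :
  exists d0 : nat, forall d : nat, (d0 <= d)%N ->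
    (12%:R / 10%:R : R) `^ Num.sqrt (d%:R : R) <= (borsuk_number R d)%:R.
Proof.
have [K1 primeK] : exists K, forall k, (K <= k)%N ->
    exists2 p, prime p & (8 * k < p <= 14 * k)%N.
  by exists (400 ^ 4)%N; exact: prime_between.
have [K2 boundK] := weighted_family_bound R.
pose K := maxn K1 K2.
(* This makes [K] itself admissible, so the largest admissible [k] is at least [K]. *)
exists ((26 * K).+1 * (26 * K).+2)%N => d dK.
have exk : exists k, ((26 * k).+1 * (26 * k).+2 <= 2 * d)%N.
  by exists K; apply: leq_trans dK _; rewrite leq_pmull.
have kbound k : ((26 * k).+1 * (26 * k).+2 <= 2 * d)%N -> (k <= 2 * d)%N.
  by apply: leq_trans; nia.
have [k kd kmax] := ex_maxnP exk kbound.
have Kk : (K <= k)%N by apply: kmax; apply: leq_trans dK _; rewrite leq_pmull.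
(* Maximality of [k] gives [2d < (26k + 27)(26k + 28)]; this is where the 28 in the exponents comes
   from. *)
have dk : (2 * d <= (26 * k + 28) ^ 2)%N.
  have : (2 * d < (26 * k.+1).+1 * (26 * k.+1).+2)%N.
    by rewrite ltnNge; apply/negP => /kmax; rewrite ltnn.
  by rewrite -mulnn; nia.
have [p pp pk] := primeK k (leq_trans (leq_maxl _ _) Kk).
have jk : (8 * k <= p.-1 <= 14 * k)%N by lia.
have [z /andP[z0 z1] bin_ge] := boundK k _ (leq_trans (leq_maxr _ _) Kk) jk.
apply: le_trans (powR_sqrt_le R dk) _.
rewrite /borsuk_number; case: ex_minnP => N /asboolP borsukN _.
set n := (26 * k)%N in kd dk bin_ge *; set g : R := 33%:R / 29%:R in bin_ge *.
pose M := #|exponents n p.-1|.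
pose V := #|[set x : signed_vec n | #|supp x| == p.-1]|.
have g1 : 1 < g by rewrite ltr_pdivlMr ?ltr0n // mul1r ltr_nat.
have M0 : (0 < M)%N.
  by apply/card_gt0P; exists [ffun=> ord0]; rewrite inE big1 // => i _; rewrite ffunE.
(* After multiplication by [z ^+ p.-1], the upper bound on [M] and the lower bound on [V] meet in
   [bin_ge]. *)
have MV : M%:R * g ^+ (n + 28) <= V%:R :> R.
  have zj : 0 < z ^+ p.-1 by rewrite exprn_gt0.
  rewrite -(ler_pM2r zj) mulrAC.
  apply: (@le_trans _ _ ((1 + z + z ^+ 2) ^+ n * g ^+ (n + 28))).
    by rewrite ler_pM2r ?exprn_gt0 ?(lt_trans _ g1) // card_exponents_bound // z0.
  apply: le_trans bin_ge _; rewrite exprMn mulrA ler_pM2r //.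
  by rewrite -natrX -natrM ler_nat card_supp.
have ltMV : (M < V)%N.
  rewrite -(ltr_nat R); apply: lt_le_trans MV; rewrite ltr_pMr ?ltr0n //.
  by rewrite exprn_egt1 // addnS.
(* Cancelling [M] in [M g^(n + 28) <= V <= N M] leaves the bound on [N]. *)
have := borsuk_bound_card pp kd borsukN ltMV.
rewrite -/V -/M -(ler_nat R) natrM => /(le_trans MV).
by rewrite mulrC ler_pM2r // ltr0n.
Qed.
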